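(* Let $z\in[0,1)$ and let $k,r\ge2$ be natural numbers. If $z$ is computably random in base $k$, then $z$ is computably random in base $r$.
   Context: For $k\ge2$, a martingale in base $k$ is a function $M\colon\{0,\dots,k-1\}^{<\omega}\to[0,\infty)$ with $\sum_{i=0}^{k-1}M(\sigma i)=kM(\sigma)$ for every string $\sigma$. It is computable if $M(\sigma)$ is a computable real uniformly in $\sigma$ (a real is computable if there is a computable sequence of rationals $(q_n)$ with $|q_n-q_{n-1}|\le2^{-n}$ converging to it). $M$ succeeds on an infinite sequence $Z$ over $\{0,\dots,k-1\}$ if $\{M(Z\upharpoonright n)\}_n$ is unbounded. $Z$ is computably random in base $k$ if no computable martingale in base $k$ succeeds on it. A real $z\in[0,1)$ is computably random in base $k$ if its base-$k$ expansion (the one with infinitely many digits different from $k-1$) is computably random in base $k$. *)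

(* Defs.v *)
From mathcomp Require Import all_boot all_order all_algebra.
From mathcomp Require Import all_classical all_reals all_analysis.

Set Implicit Arguments.
Unset Strict Implicit.
Unset Printing Implicit Defensive.

Import Order.TTheory GRing.Theory Num.Theory.
Import numFieldNormedType.Exports.

Local Open Scope classical_set_scope.
Local Open Scope ring_scope.

(* Total recursive (i.e. computable) functions on nat: the least class that
   contains the basic functions and is closed under composition, primitive
   recursion, and minimization of regular functions (those having a zero for
   every value of the parameters), so that no partial function is involved. *)
Inductive recursive : forall n : nat, (n.-tuple nat -> nat) -> Prop :=
| recursive_zero n : recursive (fun _ : n.-tuple nat => 0%N)
| recursive_succ : recursive (fun v : 1.-tuple nat => (tnth v ord0).+1)
| recursive_proj n (i : 'I_n) : recursive (fun v : n.-tuple nat => tnth v i)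
| recursive_comp m n (h : m.-tuple nat -> nat)
    (g : 'I_m -> n.-tuple nat -> nat) :
    recursive h -> (forall i, recursive (g i)) ->
    recursive (fun v : n.-tuple nat => h [tuple g i v | i < m])
| recursive_primrec n (g : n.-tuple nat -> nat) (h : n.+2.-tuple nat -> nat)
    (f : n.+1.-tuple nat -> nat) :
    recursive g -> recursive h ->
    (forall v : n.-tuple nat, f [tuple of 0%N :: v] = g v) ->
    (forall x (v : n.-tuple nat),
       f [tuple of x.+1 :: v] = h [tuple of x :: f [tuple of x :: v] :: v]) ->
    recursive f
| recursive_min n (g : n.+1.-tuple nat -> nat) (f : n.-tuple nat -> nat) :
    recursive g ->
    (forall v : n.-tuple nat, g [tuple of f v :: v] = 0%N) ->
    (forall (v : n.-tuple nat) x, (x < f v)%N -> g [tuple of x :: v] <> 0%N) ->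
    recursive f.

(* The number whose base-k numeral is 1 followed by the digits of s; the
   leading 1 makes the coding injective on strings for k >= 2. *)
Definition string_code (k : nat) (s : seq 'I_k) : nat :=
  foldl (fun (c : nat) (d : 'I_k) => (c * k + d)%N) 1%N s.

Definition computable_rat_family (k : nat) (q : seq 'I_k -> nat -> rat) : Prop :=
  exists a b c : 2.-tuple nat -> nat,
    [/\ recursive a, recursive b, recursive c &
      forall s n, let v := [tuple string_code s; n] in
        q s n = ((a v)%:R - (b v)%:R) / (c v).+1%:R].

Section Randomness.
Variable R : realType.

Definition martingale (k : nat) (M : seq 'I_k -> R) : Prop :=
  (forall s, 0 <= M s) /\
  (forall s, \sum_(i < k) M (rcons s i) = k%:R * M s).

Definition uniformly_computable (k : nat) (M : seq 'I_k -> R) : Prop :=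
  exists q : seq 'I_k -> nat -> rat,
    [/\ computable_rat_family q,
        forall s n, `|q s n.+1 - q s n| <= 2^-1 ^+ n.+1 &
        forall s, (ratr (q s n) : R) @[n --> \oo] --> M s].

Definition succeeds (k : nat) (M : seq 'I_k -> R) (Z : nat -> 'I_k) : Prop :=
  ~ has_ubound (range (fun n => M (mkseq Z n))).

Definition computably_random_seq (k : nat) (Z : nat -> 'I_k) : Prop :=
  forall M : seq 'I_k -> R,
    martingale M -> uniformly_computable M -> ~ succeeds M Z.

Definition base_expansion (k : nat) (z : R) (Z : nat -> 'I_k) : Prop :=
  series (fun i => (Z i)%:R / k%:R ^+ i.+1) @ \oo --> z /\
  (forall n, exists2 m, (n <= m)%N & (Z m : nat) <> k.-1).

(* For k >= 2 and 0 <= z < 1 there is exactly one such Z. *)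
Definition computably_random (k : nat) (z : R) : Prop :=
  exists2 Z : nat -> 'I_k, base_expansion z Z & computably_random_seq Z.

End Randomness.

(* Main.v *)
Require Import Defs.
From mathcomp Require Import all_boot all_order all_algebra.
From mathcomp Require Import all_classical all_reals all_analysis.
From mathcomp Require Import zify ring lra.

Set Implicit Arguments.
Unset Strict Implicit.
Unset Printing Implicit Defensive.

(** Let [M] be a computable base-[r] martingale that succeeds on [z], and put
    [W = 1 + M], with running maximum [W*].  Betting on [W] with the stake
    [1 / W*] gives a martingale [U] that equals [W / W*] plus a nondecreasing
    process whose exponential dominates [W* / W*_0].  Hence [U] is unbounded
    along [z], never loses more than [1] of what it has once reached, and grows
    at most linearly in the length of the string; no comparison of reals is
    needed to compute it.  Linear growth makes the distribution function of the
    measure with density [U] computable, and its increments over [k]-adic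
    intervals form a computable base-[k] martingale [N].  A [k]-adic interval
    around [z] that lies in an [r]-adic one where [U >= L + 1] only sees
    densities [>= L], so [N >= L] there.  If [z] is the left endpoint of an
    [r]-adic interval of length [r^-n0], then [k]-adic intervals may stick out
    on the left, but a fraction at least [r^-n0] of each lies on the right of
    [z], and [N] is still unbounded. *)

(** * Recursive functions of lists *)

(** Functions of plain lists avoid dependent tuple types; only the values on lists of length [n]
    matter. *)
Definition rec (n : nat) (f : seq nat -> nat) : Prop :=
  recursive (fun v : n.-tuple nat => f v).

Lemma rec_ext n f g :
  (forall v, size v = n -> f v = g v) -> rec n f -> rec n g.
Proof.
move=> fg; rewrite /rec.
suff -> : (fun v : n.-tuple nat => f v) = (fun v : n.-tuple nat => g v) by [].
by apply: funext => v; rewrite fg ?size_tuple.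
Qed.

Lemma rec_nth n i : i < n -> rec n (fun v => nth 0 v i).
Proof.
move=> lt_in; rewrite /rec.
have -> : (fun v : n.-tuple nat => nth 0 v i) = fun v => tnth v (Ordinal lt_in).
  by apply: funext => v; rewrite (tnth_nth 0).
exact: recursive_proj.
Qed.

Lemma rec_nth_behead n i : i < n -> rec n.+1 (fun v => nth 0 (behead v) i).
Proof.
move=> lt_in; apply: (rec_ext (f := fun v => nth 0 v i.+1)).
  by move=> v _; rewrite nth_behead.
exact: rec_nth.
Qed.

Lemma rec_head n : rec n.+1 (head 0).
Proof.
apply: (rec_ext (f := fun v => nth 0 v 0)); last exact: rec_nth.
by move=> v _; rewrite nth0.
Qed.

Lemma rec_subst n m f (g : nat -> seq nat -> nat) :
  rec m f -> (forall i, i < m -> rec n (g i)) ->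
  rec n (fun v => f (mkseq (g^~ v) m)).
Proof.
move=> rf rg.
have := @recursive_comp m n _ (fun i (v : n.-tuple nat) => g i v) rf
  (fun i => rg i (ltn_ord i)).
congr recursive; apply: funext => v; congr f.
by rewrite /mkseq -val_enum_ord -map_comp.
Qed.

(** The leading arguments of [f] are computed by the functions in [h], and its other [n] arguments
    are the last [n] entries of [w]. Dropping, prepending and replacing leading entries are all
    instances. *)
Lemma rec_args n p f (h : seq (seq nat -> nat)) : n <= p ->
  rec (size h + n) f ->
  (forall i, i < size h -> rec p (nth (fun=> 0) h i)) ->
  rec p (fun w => f ([seq g w | g <- h] ++ drop (p - n) w)).
Proof.
move=> le_np rf rh.
have := @rec_subst p (size h + n) f (fun i w => if i < size h
  then nth (fun=> 0) h i w else nth 0 w (p - n + (i - size h))) rf.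
move=> /(_ _)-H; apply: rec_ext (H _) => [w sw|i lt_i]; last first.
  by case: ltnP => lt_ih; [apply: rh | apply: rec_nth; lia].
congr f; apply: (@eq_from_nth _ 0).
  by rewrite size_mkseq size_cat size_map size_drop sw; lia.
move=> i; rewrite size_mkseq => lt_i; rewrite nth_mkseq // nth_cat size_map.
by case: ltnP => lt_ih; [rewrite (nth_map (fun=> 0)) | rewrite nth_drop].
Qed.

Lemma rec_behead n f : rec n f -> rec n.+1 (fun v => f (behead v)).
Proof.
move=> rf; have := @rec_args n n.+1 f [::] (leqnSn n) rf.
by rewrite subSnn => /(_ _)-H; apply: rec_ext (H _) => // v _; rewrite drop1.
Qed.

Lemma rec_cons n f g : rec n.+1 f -> rec n g -> rec n (fun v => f (g v :: v)).
Proof.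
move=> rf rg; have := @rec_args n n f [:: g] (leqnn n) rf.
rewrite subnn => /(_ _)-H; apply: rec_ext (H _) => [v _|[]//].
by rewrite drop0.
Qed.

Lemma rec_comp1 n (f : nat -> nat) g :
  rec 1 (fun v => f (nth 0 v 0)) -> rec n g -> rec n (fun v => f (g v)).
Proof. by move=> rf rg; apply: (@rec_subst n 1 _ (fun=> g) rf). Qed.

Lemma rec_comp2 n (f : nat -> nat -> nat) g h :
  rec 2 (fun v => f (nth 0 v 0) (nth 0 v 1)) -> rec n g -> rec n h ->
  rec n (fun v => f (g v) (h v)).
Proof.
move=> rf rg rh.
by apply: (@rec_subst n 2 _ (fun i => if i is 0 then g else h) rf) => -[|[]].
Qed.

Lemma rec_iteri n b g (h : nat -> nat -> seq nat -> nat) :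
  rec n b -> rec n g ->
  rec n.+2 (fun w => h (nth 0 w 0) (nth 0 w 1) (behead (behead w))) ->
  rec n (fun v => iteri (b v) (fun i x => h i x v) (g v)).
Proof.
move=> rb rg rh.
(* The number of steps is first made a separate leading argument, as primitive recursion demands;
   [b v] is substituted for it afterwards. *)
pose f w := iteri (head 0 w) (fun i x => h i x (behead w)) (g (behead w)).
suff rf : rec n.+1 f by apply: (rec_cons rf rb).
exact: (@recursive_primrec n _ _ (fun w : n.+1.-tuple nat => f w) rg rh).
Qed.

Lemma rec_succ n f : rec n f -> rec n (fun v => (f v).+1).
Proof.
apply: rec_comp1; have := recursive_succ; congr recursive.
by apply: funext => v; rewrite (tnth_nth 0).
Qed.

Lemma rec_const n c : rec n (fun=> c).
Proof. by elim: c => [|c IH]; [apply: recursive_zero | apply: rec_succ]. Qed.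

Lemma rec_add n f g : rec n f -> rec n g -> rec n (fun v => f v + g v).
Proof.
move=> rf rg.
apply: (rec_ext (f := fun v => iteri (g v) (fun i x => x.+1) (f v))).
  by move=> v _; elim: (g v) => [|x /= ->]; rewrite ?addn0 ?addnS.
by apply: (rec_iteri (h := fun i x v => x.+1)) => //; apply: rec_succ; apply: rec_nth.
Qed.

Lemma rec_pred n f : rec n f -> rec n (fun v => (f v).-1).
Proof.
move=> rf.
apply: (rec_ext (f := fun v => iteri (f v) (fun i x => i) 0)).
  by move=> v _; case: (f v).
apply: (rec_iteri (h := fun i x v => i)) => //; first exact: rec_const.
exact: rec_nth.
Qed.

Lemma rec_sub n f g : rec n f -> rec n g -> rec n (fun v => f v - g v).
Proof.
move=> rf rg.
apply: (rec_ext (f := fun v => iteri (g v) (fun i x => x.-1) (f v))).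
  by move=> v _; elim: (g v) => [|x /= ->]; rewrite ?subn0 ?subnS.
by apply: (rec_iteri (h := fun i x v => x.-1)) => //; apply: rec_pred; apply: rec_nth.
Qed.

Lemma rec_fold n b (op : nat -> nat -> nat) c (f : nat -> seq nat -> nat) :
  (forall m g h, rec m g -> rec m h -> rec m (fun v => op (g v) (h v))) ->
  rec n b -> rec n.+1 (fun w => f (head 0 w) (behead w)) ->
  rec n (fun v => iteri (b v) (fun i x => op x (f i v)) c).
Proof.
move=> rop rb rf.
apply: (rec_iteri (h := fun i x v => op x (f i v))) => //; first exact: rec_const.
apply: rop; first exact: rec_nth.
have := @rec_args n n.+2 _ [:: nth 0 ^~ 0] (leqW (leqnSn n)) rf.
have -> : n.+2 - n = 2 by lia.
move=> /(_ _)-H; apply: rec_ext (H _).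
  by move=> [//|x [//|y v]] _ /=; rewrite drop0.
by case=> // _; apply: rec_nth.
Qed.

Lemma rec_sum n b (f : nat -> seq nat -> nat) :
  rec n b -> rec n.+1 (fun w => f (head 0 w) (behead w)) ->
  rec n (fun v => \sum_(i < b v) f i v).
Proof.
move=> rb rf.
apply: rec_ext (rec_fold 0 rec_add rb rf) => v _.
by elim: (b v) => [|x /= ->]; rewrite ?big_ord0 ?big_ord_recr.
Qed.

Lemma rec_mul n f g : rec n f -> rec n g -> rec n (fun v => f v * g v).
Proof.
move=> rf rg.
apply: (rec_ext (f := fun v => \sum_(i < f v) g v)).
  by move=> v _; rewrite sum_nat_const card_ord.
by apply: (@rec_sum n f (fun _ v => g v) rf); apply: rec_behead.
Qed.

Lemma rec_exp n f g : rec n f -> rec n g -> rec n (fun v => f v ^ g v).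
Proof.
move=> rf rg.
apply: (rec_ext (f := fun v => iteri (g v) (fun i x => x * f v) 1)).
  by move=> v _; elim: (g v) => [|x /= ->]; rewrite ?expn0 ?expnSr.
apply: (rec_iteri (h := fun i x v => x * f v)) => //; first exact: rec_const.
apply: rec_mul; first exact: rec_nth.
exact: (rec_behead (rec_behead rf)).
Qed.

Lemma rec_max n f g : rec n f -> rec n g -> rec n (fun v => maxn (f v) (g v)).
Proof.
move=> rf rg; apply: (rec_ext (f := fun v => f v + (g v - f v))).
  by move=> v _; rewrite maxnE.
by apply: rec_add => //; apply: rec_sub.
Qed.

Lemma rec_leq n f g : rec n f -> rec n g -> rec n (fun v => (f v <= g v : nat)).
Proof.
move=> rf rg; apply: (rec_ext (f := fun v => 1 - (f v - g v))).
  by move=> v _; lia.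
by apply: rec_sub; [exact: rec_const | apply: rec_sub].
Qed.

Lemma rec_bigmax n b (f : nat -> seq nat -> nat) :
  rec n b -> rec n.+1 (fun w => f (head 0 w) (behead w)) ->
  rec n (fun v => \max_(i < b v) f i v).
Proof.
move=> rb rf.
apply: rec_ext (rec_fold 0 rec_max rb rf) => v _.
by elim: (b v) => [|x /= ->]; rewrite ?big_ord0 ?big_ord_recr.
Qed.

(** With this count, quotients and the lengths of coded strings can be written as bounded sums. *)
Lemma sum_ltn x y : x <= y -> \sum_(i < y) (i < x) = x.
Proof.
move=> le_xy; rewrite -(big_mkord xpredT (fun i => (i < x : nat))).
rewrite (big_cat_nat (n := x)) //= [X in _ + X]big_nat_cond [X in _ + X]big1.
  rewrite addn0 big_nat_cond (eq_bigr (fun=> 1)); last by move=> i /andP[/andP[_ ->]].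
  by rewrite -big_nat_cond sum_nat_const_nat muln1 subn0.
by move=> i /andP[/andP[xi _] _]; rewrite ltnNge xi.
Qed.

Lemma rec_div n f g : rec n f -> rec n g -> rec n (fun v => f v %/ g v).
Proof.
move=> rf rg.
(* The quotient counts the positive multiples of [g v] up to [f v]; the factor [0 < g v] gives
   division by zero its value 0. *)
apply: (rec_ext (f := fun v => (0 < g v) * \sum_(i < f v) (i.+1 * g v <= f v))).
  move=> v _; case: posnP => [->|gv0]; first by rewrite divn0.
  rewrite mul1n (eq_bigr (fun i : 'I__ => (i < f v %/ g v : nat))); last first.
    by move=> i _; rewrite leq_divRL.
  by rewrite sum_ltn ?leq_div.
apply: rec_mul; first by apply: rec_leq => //; apply: rec_const.
apply: (@rec_sum n f (fun i v => (i.+1 * g v <= f v : nat)) rf).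
apply: rec_leq; last exact: rec_behead.
by apply: rec_mul; [apply/rec_succ/rec_head | apply: rec_behead].
Qed.

Lemma rec_mod n f g : rec n f -> rec n g -> rec n (fun v => f v %% g v).
Proof.
move=> rf rg; apply: (rec_ext (f := fun v => f v - f v %/ g v * g v)).
  by move=> v _; rewrite modn_def /divn; case: edivnP => q t -> _ /=; rewrite addKn.
by apply: rec_sub => //; apply: rec_mul => //; apply: rec_div.
Qed.

Import Order.TTheory GRing.Theory Num.Theory.
Import numFieldNormedType.Exports.
Local Open Scope ring_scope.

(** * Computable families of reals *)

Section ComputableReal.
Variable R : realType.
Implicit Types (n m : nat) (v w : seq nat) (F G : seq nat -> R).

(** Rational values are taken directly in [R], so that no embedding of [rat] gets in the way of the
    arithmetic. *)
Definition crat n (q : seq nat -> R) : Prop :=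
  exists a b c, [/\ rec n a, rec n b, rec n c &
    forall v, size v = n -> q v = ((a v)%:R - (b v)%:R) / (c v).+1%:R].

(** The head of the list is the precision. An explicit distance to the limit, instead of a bound on
    successive differences, lets errors be added up. *)
Definition creal n F : Prop :=
  exists2 q, crat n.+1 q &
    forall m v, size v = n -> `|q (m :: v) - F v| <= 2^-1 ^+ m.

Lemma crat_rec n a b c : rec n a -> rec n b -> rec n c ->
  crat n (fun v => ((a v)%:R - (b v)%:R) / (c v).+1%:R).
Proof. by move=> ra rb rc; exists a, b, c. Qed.

Lemma crat_subst n m q (g : nat -> seq nat -> nat) :
  crat m q -> (forall i, (i < m)%N -> rec n (g i)) ->
  crat n (fun v => q (mkseq (g^~ v) m)).
Proof.
move=> [a [b [c [ra rb rc qE]]]] rg.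
exists (fun v => a (mkseq (g^~ v) m)), (fun v => b (mkseq (g^~ v) m)),
  (fun v => c (mkseq (g^~ v) m)).
by split=> [||| v _]; [exact: rec_subst.. | rewrite qE ?size_mkseq].
Qed.

Lemma rec_reprecise n f e : rec n.+1 f -> rec n.+1 e ->
  rec n.+1 (fun w => f (e w :: behead w)).
Proof.
move=> rf re; have := @rec_args n n.+1 f [:: e] (leqnSn n) rf.
rewrite subSnn => /(_ _)-H; apply: rec_ext (H _) => [v _|[]//].
by rewrite drop1.
Qed.

Lemma crat_reprecise n q e : crat n.+1 q -> rec n.+1 e ->
  crat n.+1 (fun w => q (e w :: behead w)).
Proof.
move=> [a [b [c [ra rb rc qE]]]] re.
exists (fun w => a (e w :: behead w)), (fun w => b (e w :: behead w)),
  (fun w => c (e w :: behead w)).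
split=> [||| v sv]; [exact: rec_reprecise.. | rewrite qE //].
by rewrite /= size_behead sv.
Qed.

Lemma crat_add n p q : crat n p -> crat n q -> crat n (fun v => p v + q v).
Proof.
move=> [a [b [c [ra rb rc pE]]]] [a' [b' [c' [ra' rb' rc' qE]]]].
exists (fun v => a v * (c' v).+1 + a' v * (c v).+1)%N,
  (fun v => b v * (c' v).+1 + b' v * (c v).+1)%N,
  (fun v => ((c v).+1 * (c' v).+1).-1)%N.
split=> [||| v sv].
- by apply: rec_add; apply: rec_mul => //; apply: rec_succ.
- by apply: rec_add; apply: rec_mul => //; apply: rec_succ.
- by apply: rec_pred; apply: rec_mul; apply: rec_succ.
rewrite pE // qE // prednK ?muln_gt0 // !(natrD, natrM).
have : (c v).+1%:R != 0 :> R by rewrite pnatr_eq0.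
have : (c' v).+1%:R != 0 :> R by rewrite pnatr_eq0.
by move: (_.+1%:R) (_.+1%:R) => x y x0 y0; field; rewrite x0 y0.
Qed.

Lemma crat_opp n q : crat n q -> crat n (fun v => - q v).
Proof.
move=> [a [b [c [ra rb rc qE]]]]; exists b, a, c; split=> // v sv.
by rewrite qE // -mulNr opprB.
Qed.

Lemma crat_mul n p q : crat n p -> crat n q -> crat n (fun v => p v * q v).
Proof.
move=> [a [b [c [ra rb rc pE]]]] [a' [b' [c' [ra' rb' rc' qE]]]].
exists (fun v => a v * a' v + b v * b' v)%N,
  (fun v => a v * b' v + b v * a' v)%N,
  (fun v => ((c v).+1 * (c' v).+1).-1)%N.
split=> [||| v sv].
- by apply: rec_add; apply: rec_mul.
- by apply: rec_add; apply: rec_mul.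
- by apply: rec_pred; apply: rec_mul; apply: rec_succ.
rewrite pE // qE // prednK ?muln_gt0 // !(natrD, natrM).
have : (c v).+1%:R != 0 :> R by rewrite pnatr_eq0.
have : (c' v).+1%:R != 0 :> R by rewrite pnatr_eq0.
by move: (_.+1%:R) (_.+1%:R) => x y x0 y0; field; rewrite x0 y0.
Qed.

Lemma half_exp_gt0 m : 0 < 2^-1 ^+ m :> R.
Proof. by rewrite exprn_gt0 // invr_gt0. Qed.

Lemma half_exp_ge0 m : 0 <= 2^-1 ^+ m :> R.
Proof. exact/ltW/half_exp_gt0. Qed.

Lemma half_expS m : 2^-1 ^+ m = 2^-1 ^+ m.+1 + 2^-1 ^+ m.+1 :> R.
Proof. by rewrite exprS; field. Qed.

(** Since [s < 2 ^ s], a factor of at most [s] is absorbed by [s] further bits of precision. *)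
Lemma mulr_half_exp_le (x : R) s m :
  x <= s%:R -> x * 2^-1 ^+ (m + s) <= 2^-1 ^+ m.
Proof.
move=> xs; rewrite exprD mulrCA; apply: ler_piMr; first exact: half_exp_ge0.
rewrite exprVn ler_pdivrMr ?exprn_gt0 // mul1r (le_trans xs) //.
by rewrite -natrX ler_nat ltnW // ltn_expl.
Qed.

Lemma creal_subst n m F (g : nat -> seq nat -> nat) :
  creal m F -> (forall i, (i < m)%N -> rec n (g i)) ->
  creal n (fun v => F (mkseq (g^~ v) m)).
Proof.
move=> [q cq qF] rg.
exists (fun w => q (mkseq (fun i =>
  if i is j.+1 then g j (behead w) else head 0%N w) m.+1)).
  apply: (crat_subst (g := fun i w =>
    if i is j.+1 then g j (behead w) else head 0%N w) cq).
  by case=> [|i] lt_i; [apply: rec_head | apply: rec_behead; apply: rg].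
move=> x v sv; have -> : mkseq (fun i => if i is j.+1 then g j (behead (x :: v))
    else head 0%N (x :: v)) m.+1 = x :: mkseq (g^~ v) m.
  by rewrite /mkseq /= -[1%N]addn0 iotaDl -map_comp.
by apply: qF; rewrite size_mkseq.
Qed.

Lemma creal_comp2 n (F : nat -> nat -> R) g h :
  creal 2 (fun v => F (nth 0 v 0) (nth 0 v 1))%N -> rec n g -> rec n h ->
  creal n (fun v => F (g v) (h v)).
Proof.
move=> cF rg rh.
by apply: (@creal_subst n 2 _ (fun i => if i is 0%N then g else h) cF) => -[|[]].
Qed.

Lemma creal_nat n f : rec n f -> creal n (fun v => (f v)%:R).
Proof.
move=> rf; exists (fun w => (f (behead w))%:R).
  exists (fun w => f (behead w)), (fun=> 0%N), (fun=> 0%N).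
  split; [exact: rec_behead | exact: rec_const.. |].
  by move=> w _; rewrite subr0 divr1.
by move=> m v _; rewrite subrr normr0 half_exp_ge0.
Qed.

Lemma creal_add n F G : creal n F -> creal n G -> creal n (fun v => F v + G v).
Proof.
move=> [p cp pF] [q cq qG].
exists (fun w => p ((head 0%N w).+1 :: behead w) + q ((head 0%N w).+1 :: behead w)).
  by apply: crat_add; apply: crat_reprecise => //; apply/rec_succ/rec_head.
move=> m v sv /=; rewrite opprD addrACA (le_trans (ler_normD _ _)) //.
by rewrite half_expS lerD ?pF ?qG.
Qed.

Lemma creal_opp n F : creal n F -> creal n (fun v => - F v).
Proof.
move=> [q cq qF]; exists (fun w => - q w); first exact: crat_opp.
by move=> m v sv; rewrite -opprD normrN qF.
Qed.

Lemma creal_bound n F : creal n F ->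
  exists2 s, rec n s & forall v, size v = n -> `|F v| <= (s v)%:R.
Proof.
move=> [q [a [b [c [ra rb rc qE]]]] qF].
(* The approximation with error at most 1 is bounded by [a + b], as its denominator is at least
   1. *)
exists (fun v => (a (0 :: v) + b (0 :: v) + 1)%N).
  apply: rec_add; last exact: rec_const.
  by apply: rec_add; apply: rec_cons => //; apply: rec_const.
move=> v sv; rewrite natrD -(subKr (q (0%N :: v)) (F v)).
rewrite (le_trans (ler_normB _ _)) // lerD ?qF //.
rewrite qE /= ?sv // normrM [X in _ * X]ger0_norm ?invr_ge0 //.
rewrite ler_pdivrMr ?ltr0n // (le_trans (ler_normB _ _)) // !normr_nat -natrD.
by rewrite -natrM ler_nat leq_pmulr.
Qed.

Lemma creal_mul n F G : creal n F -> creal n G -> creal n (fun v => F v * G v).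
Proof.
move=> cF cG; have [s rs Fs] := creal_bound cF; have [t rt Gt] := creal_bound cG.
move: cF cG => [p cp pF] [q cq qG].
(* The error of the product is at most [|x - F v| * |y| + |F v| * |y - G v|], where [|F v| <= s v]
   and [|y| <= t v + 1]; hence [s v + t v + 1] further bits suffice. *)
pose e w := (head 0 w + (s (behead w) + (t (behead w) + 1)))%N.
have re : rec n.+1 e.
  apply: rec_add; first exact: rec_head.
  apply: rec_add; first exact: rec_behead.
  by apply: rec_add; [exact: rec_behead | exact: rec_const].
exists (fun w => p (e w :: behead w) * q (e w :: behead w)).
  by apply: crat_mul; apply: crat_reprecise.
move=> m v sv; have {}pF := pF (e (m :: v)) v sv; have {}qG := qG (e (m :: v)) v sv.
move: pF qG; rewrite /e /=; set x := p _; set y := q _; set d := 2^-1 ^+ _ => pF qG.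
have d1 : d <= 1 by rewrite exprn_ile1 // ?invr_ge0 ?invf_le1 // ler1n.
have {}Fs := Fs v sv; have {}Gt := Gt v sv.
have -> : x * y - F v * G v = (x - F v) * y + F v * (y - G v) by ring.
have yt : `|y| <= (t v)%:R + 1.
  rewrite -(subrK (G v) y) (le_trans (ler_normD _ _)) // addrC lerD //.
  exact: le_trans d1.
apply: le_trans (_ : ((s v + (t v + 1))%:R) * d <= _); last exact: mulr_half_exp_le.
rewrite (le_trans (ler_normD _ _)) // !normrM !natrD [leRHS]mulrDl addrC.
apply: lerD; first exact: ler_pM.
by rewrite mulrC ler_pM.
Qed.

(** A common denominator for each precision reduces sums and maxima of reals to those of natural
    numbers. Half of the error comes from [q], the other half from rounding down the positive and
    the negative part: both roundings err in the same direction, and their errors are subtracted. *)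
Lemma creal_dyadic n F : creal n F -> exists a b, [/\ rec n.+1 a, rec n.+1 b &
  forall m v, size v = n ->
    `|((a (m :: v))%:R - (b (m :: v))%:R) * 2^-1 ^+ m.+1 - F v| <= 2^-1 ^+ m].
Proof.
move=> [q [a [b [c [ra rb rc qE]]]] qF].
pose e w := ((head 0 w).+1 :: behead w)%N.
pose f (a : seq nat -> nat) w := ((a (e w) * 2 ^ (head 0 w).+1) %/ (c (e w)).+1)%N.
have rf g : rec n.+1 g -> rec n.+1 (f g).
  move=> rg; apply: rec_div.
    apply: rec_mul; first by apply: rec_reprecise => //; apply/rec_succ/rec_head.
    by apply: rec_exp; [exact: rec_const | apply/rec_succ/rec_head].
  by apply: rec_succ; apply: rec_reprecise => //; apply/rec_succ/rec_head.
exists (f a), (f b); split=> [|| m v sv]; try exact: rf.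
rewrite /f /e /=; set E := 2^-1 ^+ m.+1.
have fl (x y : nat) : let z := x%:R / y.+1%:R - ((x * 2 ^ m.+1) %/ y.+1)%:R * E :> R in
    0 <= z <= E.
  have E0 : 0 < E by apply: half_exp_gt0.
  have EE : E * (2 ^ m.+1)%:R = 1 by rewrite /E exprVn natrX mulVf // expf_neq0.
  have y0 : 0 < y.+1%:R :> R by rewrite ltr0n.
  have xE : x%:R / y.+1%:R = (x * 2 ^ m.+1)%:R * E / y.+1%:R :> R.
    by rewrite natrM -[_ * _ * E]mulrA [_ * E]mulrC EE mulr1.
  rewrite /= xE; move: (x * _)%N => u; set d := (u %/ y.+1)%N.
  have -> : u%:R * E / y.+1%:R - d%:R * E = E * (u%:R / y.+1%:R - d%:R) by ring.
  apply/andP; split.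
    apply: mulr_ge0; first exact: ltW.
    by rewrite subr_ge0 ler_pdivlMr // -natrM ler_nat leq_trunc_div.
  apply: ler_piMr; first exact: ltW.
  by rewrite lerBlDr ler_pdivrMr // -(natrD _ 1) -natrM ler_nat ltnW // ltn_ceil.
have := qF m.+1 v sv; rewrite qE /= ?sv //.
have := fl (a (m.+1 :: v)) (c (m.+1 :: v)).
have := fl (b (m.+1 :: v)) (c (m.+1 :: v)).
rewrite /= (half_expS m) !ler_norml -/E mulrBl.
move: (_ / _) (_ / _) => x y.
by move=> /andP[? ?] /andP[? ?] /andP[? ?]; apply/andP; split; lra.
Qed.

Lemma creal_dyadic_ge0 n F : creal n F -> (forall v, size v = n -> 0 <= F v) ->
  exists2 a, rec n.+1 a & forall m v, size v = n ->
    `|(a (m :: v))%:R * 2^-1 ^+ m.+1 - F v| <= 2^-1 ^+ m.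
Proof.
move=> /creal_dyadic[a [b [ra rb abF]]] F0.
(* Where truncated subtraction puts 0 in place of a negative number, the approximation only moves
   closer to [F v >= 0]. *)
exists (fun w => a w - b w)%N; first exact: rec_sub.
move=> m v sv; have := abF m v sv; have := F0 v sv.
case: (leqP (b (m :: v)) (a (m :: v))) => [ba|/ltnW ab]; first by rewrite natrB.
have := ab; rewrite -subn_eq0 => /eqP-> {F0 abF}.
rewrite mul0r add0r normrN => F0; rewrite (ger0_norm F0); apply: le_trans.
rewrite distrC (le_trans _ (ler_norm _)) // lerBrDr gerDl mulr_le0_ge0 //.
  by rewrite subr_le0 ler_nat.
Qed.

Lemma dist_max_le (x y x' y' e : R) : `|x - x'| <= e -> `|y - y'| <= e ->
  `|Num.max x y - Num.max x' y'| <= e.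
Proof.
rewrite !ler_norml => /andP[? ?] /andP[? ?].
by case: (leP x y); case: (leP x' y') => ? ?; apply/andP; split; lra.
Qed.

Lemma creal_inv n F : creal n F -> (forall v, size v = n -> 1 <= F v) ->
  creal n (fun v => (F v)^-1).
Proof.
move=> cF F1; have [//|a ra aF] := creal_dyadic_ge0 cF.
  by move=> v /F1; apply: le_trans.
(* The approximation is replaced by its maximum with 1, whose numerator is [E]. This brings it no
   farther from [F v >= 1], and inversion is 1-Lipschitz on [[1, oo)]. *)
pose E w := (2 ^ (head 0 w).+1)%N.
pose y w : R := (maxn (E w) (a w))%:R * 2^-1 ^+ (head 0%N w).+1.
have rE : rec n.+1 E by apply: rec_exp; [exact: rec_const | apply/rec_succ/rec_head].
have E0 w : (0 < E w)%N by rewrite expn_gt0.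
have EV w : (E w)%:R * 2^-1 ^+ (head 0%N w).+1 = 1 :> R.
  by rewrite exprVn natrX mulfV // expf_neq0.
exists (fun w => (y w)^-1).
  exists E, (fun=> 0%N), (fun w => (maxn (E w) (a w)).-1).
  split=> [|||w _]; [by []|exact: rec_const|by apply: rec_pred; apply: rec_max|].
  by rewrite subr0 prednK ?leq_max ?E0 // /y invfM mulrC exprVn invrK natrX.
move=> m v sv; have Fv1 := F1 v sv.
have y1 : 1 <= y (m :: v).
  rewrite -(EV (m :: v)); apply: ler_wpM2r; first exact: half_exp_ge0.
  by rewrite ler_nat leq_maxl.
have yF : `|y (m :: v) - F v| <= 2^-1 ^+ m.
  rewrite /y natr_max maxr_pMl ?half_exp_ge0 // EV.
  have -> : F v = Num.max 1 (F v) by apply/esym/max_idPr.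
  by apply: dist_max_le; [rewrite subrr normr0 half_exp_ge0 | apply: aF].
move: (y _) y1 yF => x x1 xF; apply: le_trans xF.
have x0 : 0 < x by lra.
have F0 : 0 < F v by lra.
have -> : x^-1 - (F v)^-1 = (F v - x) / (x * F v).
  by field; rewrite !gt_eqF.
rewrite normrM distrC ler_piMr // normfV invf_le1 ?normr_gt0 ?mulf_neq0 ?gt_eqF //.
by rewrite gtr0_norm ?mulr_gt0 // mulr_ege1.
Qed.

(** A diagonal argument: [G m.+1] computed with precision [m.+1] has two errors of at most half of
    [2^-m] each. *)
Lemma creal_lim n (G : nat -> seq nat -> R) F :
  creal n.+1 (fun w => G (head 0%N w) (behead w)) ->
  (forall m v, size v = n -> `|G m v - F v| <= 2^-1 ^+ m) -> creal n F.
Proof.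
move=> [q [a [b [c [ra rb rc qE]]]] qG] GF.
pose e w := [:: (head 0 w).+1, (head 0 w).+1 & behead w]%N.
have re g : rec n.+2 g -> rec n.+1 (fun w => g (e w)).
  move=> rg; have rh : rec n.+1 (fun w => (head 0 w).+1)%N by apply/rec_succ/rec_head.
  have := @rec_args n n.+1 g [:: fun w => (head 0 w).+1; fun w => (head 0 w).+1]%N
    (leqnSn n) rg.
  rewrite subSnn => /(_ _)-H; apply: rec_ext (H _) => [v _|[|[]]//].
  by rewrite drop1.
exists (fun w => q (e w)).
  exists (fun w => a (e w)), (fun w => b (e w)), (fun w => c (e w)).
  by split; [exact: re.. | move=> v sv; rewrite qE //= size_behead sv].
move=> m v sv; rewrite -(subrKA (G m.+1 v)) (le_trans (ler_normD _ _)) //.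
by rewrite half_expS lerD ?GF // (qG m.+1 (m.+1 :: v)) //= sv.
Qed.

(** Under a sum or maximum the bound variable comes first and the precision second, whereas [f]
    takes the precision, here raised by [e], in front. *)
Lemma rec_under_binder n f e : rec n.+2 f -> rec n e ->
  rec n.+2 (fun w => f [:: nth 0 w 1 + e (behead (behead w)), head 0 w
                           & behead (behead w)])%N.
Proof.
move=> rf re; have re' := rec_behead (rec_behead re).
have := @rec_args n n.+2 f [:: fun w => nth 0 w 1 + e (behead (behead w)); head 0]%N
  (leqW (leqnSn n)) rf.
have -> : (n.+2 - n = 2)%N by lia.
move=> /(_ _)-H; apply: rec_ext (H _) => [[//|x [//|y v]] _|[|[]]//] /=.
- by rewrite drop0.
- by move=> _; apply: rec_add => //; apply: rec_nth.
- by move=> _; apply: rec_head.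
Qed.

Lemma creal_sum n b (F : nat -> seq nat -> R) :
  rec n b -> creal n.+1 (fun w => F (head 0%N w) (behead w)) ->
  creal n (fun v => \sum_(i < b v) F i v).
Proof.
move=> rb /creal_dyadic[p [q [rp rq pqF]]].
(* Each of the [b v] summands is computed with [b v] further bits, so that the errors add up to at
   most [2^-m]. *)
pose f (p : seq nat -> nat) w :=
  (\sum_(i < b (behead w)) p [:: head 0 w + b (behead w), nat_of_ord i & behead w])%N.
have rf g : rec n.+2 g -> rec n.+1 (f g).
  move=> rg; apply: (@rec_sum n.+1 (fun w => b (behead w))
    (fun i w => g [:: head 0 w + b (behead w), i & behead w])%N).
    exact: rec_behead.
  by apply: rec_ext (rec_under_binder rg rb) => -[|x [|y v]].
exists (fun w => ((f p w)%:R - (f q w)%:R) / ((2 ^ (head 0 w + b (behead w)).+1).-1).+1%:R)%N.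
  apply: crat_rec; [exact: rf..|].
  apply/rec_pred/rec_exp; [exact: rec_const | apply/rec_succ/rec_add].
    exact: rec_head.
  exact: rec_behead.
move=> m v sv; rewrite prednK ?expn_gt0 // natrX -exprVn /f /= !natr_sum.
rewrite -sumrB mulr_suml -sumrB.
apply: le_trans (ler_norm_sum _ _ _) _.
apply: le_trans (_ : \sum_(i < b v) 2^-1 ^+ (m + b v) <= _).
  by apply: ler_sum => i _; apply: (pqF _ (nat_of_ord i :: v)); rewrite /= sv.
by rewrite sumr_const card_ord -[leLHS]mulr_natl mulr_half_exp_le.
Qed.

(** The start value 1 is the lower bound of the processes whose running maximum is taken. *)
Fixpoint max1_upto (F : nat -> R) n : R :=
  if n is m.+1 then Num.max (max1_upto F m) (F m) else 1.

(** The maximum is 1-Lipschitz for the sup norm, so it can be taken on dyadic numerators of the same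
    precision, without comparing reals. *)
Lemma creal_max1_upto n b (F : nat -> seq nat -> R) :
  rec n b -> creal n.+1 (fun w => F (head 0%N w) (behead w)) ->
  (forall i v, 0 <= F i v) ->
  creal n (fun v => max1_upto (F^~ v) (b v)).
Proof.
move=> rb cF F0; have [//|p rp pF] := creal_dyadic_ge0 cF.
pose f w := maxn (2 ^ (head 0 w).+1)%N
  (\max_(i < b (behead w)) p [:: head 0%N w, nat_of_ord i & behead w]).
have rE : rec n.+1 (fun w => 2 ^ (head 0 w).+1)%N.
  by apply: rec_exp; [exact: rec_const | apply/rec_succ/rec_head].
exists (fun w => ((f w)%:R - 0%:R) / ((2 ^ (head 0 w).+1).-1).+1%:R)%N.
  apply: crat_rec; [|exact: rec_const|exact: rec_pred].
  apply: rec_max => //.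
  apply: (@rec_bigmax n.+1 (fun w => b (behead w))
    (fun i w => p [:: head 0 w, i & behead w])%N).
    exact: rec_behead.
  have := rec_under_binder rp (rec_const n 0).
  by apply: rec_ext => -[|x [|y v]] //= _; rewrite addn0.
move=> m v sv; rewrite prednK ?expn_gt0 // natrX -exprVn /f /= subr0.
elim: (b v) => [|x IH].
  by rewrite big_ord0 maxn0 natrX exprVn mulfV ?expf_neq0 // subrr normr0
    half_exp_ge0.
rewrite big_ord_recr /= maxnA natr_max maxr_pMl ?half_exp_ge0 //.
by apply: dist_max_le => //; apply: (pF m (x :: v)); rewrite /= sv.
Qed.

End ComputableReal.

(** * Martingales indexed by r-adic intervals *)

(* X n j is the capital on [j / r^n, (j + 1) / r^n). *)
Definition gmartingale (R : realType) (r : nat) (X : nat -> nat -> R) : Prop :=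
  forall n j, \sum_(i < r) X n.+1 (j * r + i)%N = r%:R * X n j.

(** * The savings transform of a martingale that is at least 1 *)

Section Savings.
Variables (R : realType) (r : nat) (W : nat -> nat -> R).
Hypotheses (r_gt0 : (0 < r)%N) (W_ge1 : forall n j, 1 <= W n j).
Hypothesis W_mart : gmartingale r W.

Lemma gmartingale_le n j : W n.+1 j <= r%:R * W n (j %/ r).
Proof.
rewrite -W_mart {1}(divn_eq j r) (bigD1 (Ordinal (ltn_pmod j r_gt0))) //=.
rewrite lerDl sumr_ge0 // => i _; exact: le_trans (W_ge1 _ _).
Qed.

(** The interval of level [i] that contains the interval [j] of level [n] has index
    [j %/ r ^ (n - i)], so this is the maximum of [W] along the path to [j]. *)
Definition runmax n j : R := max1_upto (fun i => W i (j %/ r ^ (n - i))%N) n.+1.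

Lemma eq_max1_upto (F G : nat -> R) n :
  (forall i, (i < n)%N -> F i = G i) -> max1_upto F n = max1_upto G n.
Proof.
elim: n => //= n IH FG; rewrite FG // IH // => i lt_in.
by apply: FG; apply: ltnW.
Qed.

Lemma divn_expS j n i : (i <= n)%N -> (j %/ r ^ (n.+1 - i) = j %/ r %/ r ^ (n - i))%N.
Proof. by move=> le_in; rewrite subSn // expnS divnMA. Qed.

Lemma runmax0 j : runmax 0 j = W 0 j.
Proof. by rewrite /runmax /= expn0 divn1; apply/max_idPr. Qed.

Lemma runmaxS n j : runmax n.+1 j = Num.max (runmax n (j %/ r)) (W n.+1 j).
Proof.
rewrite {1}/runmax [LHS]/= subnn expn0 divn1; congr Num.max.
by rewrite -/(max1_upto _ n.+1); apply: eq_max1_upto => i ?; rewrite divn_expS.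
Qed.

Lemma runmax_ge n j : W n j <= runmax n j.
Proof. by case: n => [|n]; rewrite ?runmax0 // runmaxS le_max lexx orbT. Qed.

Lemma runmax_ge1 n j : 1 <= runmax n j.
Proof. exact: le_trans (runmax_ge n j). Qed.

Lemma runmax_gt0 n j : 0 < runmax n j.
Proof. exact: lt_le_trans (runmax_ge1 n j). Qed.

(* The predictable stake 1 / runmax makes the gains of W logarithmic, and all
   of them but at most 1 are never lost again (savingE). *)
Definition saving n j : R := 1 + \sum_(i < n)
  (W i.+1 (j %/ r ^ (n - i.+1))%N - W i (j %/ r ^ (n - i))%N)
    / runmax i (j %/ r ^ (n - i))%N.

Lemma savingS n j : saving n.+1 j =
  saving n (j %/ r) + (W n.+1 j - W n (j %/ r)) / runmax n (j %/ r).
Proof.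
rewrite /saving big_ord_recr /= subnn subSnn expn1 expn0 divn1 addrA.
congr (_ + _ + _); apply: eq_bigr => i _.
by rewrite !divn_expS // ltnW.
Qed.

(** The nondecreasing part of [saving]: it grows only when [W] reaches a new maximum, by the
    relative increase of that maximum. *)
Fixpoint banked (n j : nat) : R :=
  if n is m.+1 then banked m (j %/ r)%N + (runmax n j / runmax m (j %/ r) - 1) else 0.

(** By induction. Without a new maximum the gain is the change of [W / runmax]; at a new maximum
    this quotient becomes 1 and the excess of the gain is banked. *)
Lemma savingE n j : saving n j = W n j / runmax n j + banked n j.
Proof.
elim: n j => [|n IH] j.
  rewrite /saving big_ord0 runmax0 divff ?addr0 //.
  by rewrite gt_eqF // (lt_le_trans _ (W_ge1 _ _)).
rewrite savingS IH /= runmaxS.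
have A0 := runmax_gt0 n (j %/ r); set A := runmax _ _ in A0 *.
have W0 : 0 < W n.+1 j by apply: lt_le_trans (W_ge1 _ _).
case: leP => _.
  by field; rewrite !gt_eqF.
by field; rewrite gt_eqF.
Qed.

Lemma banked_incr n j : banked n (j %/ r) <= banked n.+1 j.
Proof.
rewrite /= lerDl subr_ge0 ler_pdivlMr ?runmax_gt0 // mul1r runmaxS.
by rewrite le_max lexx.
Qed.

Lemma banked_ge0 n j : 0 <= banked n j.
Proof. by elim: n j => // n IH j; apply: le_trans (banked_incr n j). Qed.

Lemma banked_mono n l j : banked n (j %/ r ^ l)%N <= banked (n + l) j.
Proof.
elim: l j => [|l IH] j; first by rewrite expn0 divn1 addn0.
rewrite addnS expnS divnMA; apply: le_trans (IH _) _; exact: banked_incr.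
Qed.

Lemma saving_bounds n j : banked n j <= saving n j <= banked n j + 1.
Proof.
rewrite savingE lerDr addrC lerD2l ler_pdivrMr ?runmax_gt0 // mul1r runmax_ge andbT.
by rewrite divr_ge0 ?(le_trans _ (W_ge1 _ _)) // ltW ?runmax_gt0.
Qed.

Lemma saving_ge0 n j : 0 <= saving n j.
Proof.
by have /andP[+ _] := saving_bounds n j; apply: le_trans; apply: banked_ge0.
Qed.

(** [saving] stays between [banked] and [banked + 1], and [banked] never decreases. *)
Lemma saving_keep n l j : saving n (j %/ r ^ l)%N - 1 <= saving (n + l) j.
Proof.
have /andP[_ le1] := saving_bounds n (j %/ r ^ l)%N.
have /andP[le2 _] := saving_bounds (n + l) j.
have := banked_mono n l j; lra.
Qed.

(** One step multiplies [W], and so the running maximum, by at most [r]; hence at most [r] is banked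
    per step. *)
Lemma saving_le n j : saving n j <= (1 + n * r)%:R.
Proof.
have /andP[_ /le_trans->//] := saving_bounds n j.
rewrite addrC natrD lerD2l.
elim: n j => [|n IH] j; first by rewrite mul0n.
rewrite /= mulSn addnC natrD lerD // lerBlDr ler_pdivrMr ?runmax_gt0 //.
apply: le_trans (_ : r%:R * runmax n (j %/ r) <= _); last first.
  by rewrite ler_wpM2r ?lerDl // ltW ?runmax_gt0.
rewrite runmaxS ge_max ler_peMl ?ler1n ?(ltW (runmax_gt0 _ _)) //=.
apply: le_trans (gmartingale_le n j) _.
by rewrite ler_wpM2l ?runmax_ge.
Qed.

(** By [1 + x <= expR x], each factor by which the running maximum grows is at most the exponential
    of the amount banked in that step. *)
Lemma saving_unbounded n j : W n j <= W 0 (j %/ r ^ n)%N * expR (saving n j).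
Proof.
apply: le_trans (runmax_ge n j) _.
apply: le_trans (_ : W 0 (j %/ r ^ n)%N * expR (banked n j) <= _); last first.
  rewrite ler_wpM2l ?(le_trans _ (W_ge1 _ _)) // ler_expR.
  by have /andP[] := saving_bounds n j.
elim: n j => [|n IH] j; first by rewrite runmax0 /= expR0 mulr1 expn0 divn1.
rewrite /= expRD mulrA expnS divnMA.
set A := runmax n _; have A0 : 0 < A by apply: runmax_gt0.
rewrite -[leLHS](divfK (lt0r_neq0 A0)) mulrC.
have := expR_ge1Dx (runmax n.+1 j / A - 1); rewrite [1 + _]addrC subrK => le1.
apply: ler_pM => //; [exact: ltW | | exact: IH].
by rewrite divr_ge0 // ltW // runmax_gt0.
Qed.

(** The stake depends on the parent interval only, and the gains of [W] over its children sum to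
    zero. *)
Lemma saving_mart : gmartingale r saving.
Proof.
move=> n j.
rewrite (eq_bigr (fun i : 'I_r => saving n j - W n j / runmax n j
  + W n.+1 (j * r + i)%N / runmax n j)); last first.
  move=> i _; rewrite savingS divnMDl // divn_small // addn0 mulrBl; ring.
rewrite big_split /= sumr_const card_ord -mulr_suml W_mart -mulr_natl; ring.
Qed.

End Savings.

Lemma le_half_exp (R : realType) (x y c : R) :
  (forall m, x <= y + c * 2^-1 ^+ m) -> x <= y.
Proof.
move=> le_xy; apply/ler_addgt0Pr => e e0.
have le_s := le_trans (ler_norm (c / e)) (ltW (archi_boundP (normr_ge0 (c / e)))).
have := mulr_half_exp_le 0 le_s; rewrite add0n expr0 mulrAC ler_pdivrMr // mul1r.
by move=> le_e; apply: le_trans (le_xy _) _; rewrite lerD2l; apply: le_e.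
Qed.

(** * The measure with density [U] and its distribution function *)

Section Measure.
Variables (R : realType) (r : nat) (U : nat -> nat -> R).
Hypotheses (r_gt1 : (1 < r)%N) (U_ge0 : forall n j, 0 <= U n j).
Hypothesis U_mart : gmartingale r U.
Hypothesis U_le : forall n j, U n j <= (1 + n * r)%:R.

Let r_gt0 : (0 < r)%N. Proof. exact: ltnW. Qed.

Let rn_gt0 n : (0 < r ^ n)%N. Proof. by rewrite expn_gt0 r_gt0. Qed.

(** The measure of [[0, J / r^n)], computed from the densities of level [n]. *)
Definition mass n J : R := (\sum_(j < J) U n j) / (r ^ n)%:R.

(** The martingale property says that subdividing the cells preserves their mass. *)
Lemma massM n J : mass n.+1 (J * r) = mass n J.
Proof.
rewrite /mass expnS natrM invfM mulrA; congr (_ / _).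
have r0 : r%:R != 0 :> R by rewrite pnatr_eq0 -lt0n.
suff -> : \sum_(j < J * r) U n.+1 j = r%:R * \sum_(j < J) U n j by field.
elim: J => [|J IH]; first by rewrite mul0n !big_ord0 mulr0.
rewrite big_ord_recr /= mulrDr -IH -U_mart.
by rewrite -(big_mkord xpredT (U n.+1)) mulSn addnC big_mkord big_split_ord.
Qed.

Lemma mass_sub n J K : (J <= K)%N ->
  mass n K - mass n J = (\sum_(J <= j < K) U n j) / (r ^ n)%:R.
Proof.
move=> JK; rewrite /mass -mulrBl -!(big_mkord xpredT (U n)).
congr (_ / _); rewrite (big_cat_nat (leq0n J) JK) /=.
by rewrite addrAC subrr add0r.
Qed.

Lemma mass_mono n J K : (J <= K)%N -> mass n J <= mass n K.
Proof.
by move=> JK; rewrite -subr_ge0 mass_sub // divr_ge0 // sumr_ge0.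
Qed.

Lemma massS n J : mass n J.+1 <= mass n J + (1 + n * r)%:R / (r ^ n)%:R.
Proof.
rewrite -lerBlDl mass_sub // big_nat1 ler_wpM2r ?invr_ge0 //.
Qed.

(** Here [p / q] is rounded down to a multiple of [r^-n]; [cumul_upper] goes to the right end of the
    cell of [p / q] instead. The two squeeze the mass of [[0, p / q)] monotonically and differ by
    one cell. *)
Definition cumul_approx n p q : R := mass n (p * r ^ n %/ q).

Definition cumul_upper n p q : R := mass n (p * r ^ n %/ q).+1.

Lemma cumul_approx_mono p q n m : (0 < q)%N -> (n <= m)%N ->
  cumul_approx n p q <= cumul_approx m p q.
Proof.
move=> q0 /subnK <-; elim: (m - n)%N => // l; rewrite addSn => /le_trans-> //.
rewrite /cumul_approx -massM mass_mono // leq_divRL // mulnAC expnSr mulnA.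
by rewrite leq_mul2r leq_trunc_div orbT.
Qed.

Lemma cumul_upper_mono p q n m : (0 < q)%N -> (n <= m)%N ->
  cumul_upper m p q <= cumul_upper n p q.
Proof.
move=> q0 /subnK <-; elim: (m - n)%N => // l; rewrite addSn; apply: le_trans.
rewrite /cumul_upper -[leRHS]massM mass_mono // ltn_divLR // mulnAC expnSr mulnA.
by rewrite ltn_mul2r r_gt0 ltn_ceil.
Qed.

Lemma cumul_approx_le_upper p q n m : (0 < q)%N -> cumul_approx n p q <= cumul_upper m p q.
Proof.
move=> q0; apply: le_trans (cumul_approx_mono p q0 (leq_maxl n m)) _.
apply: le_trans (cumul_upper_mono p q0 (leq_maxr n m)).
exact: mass_mono.
Qed.

(* The mass of the interval [0, p / q). *)
Definition cumul p q : R := sup (range (fun n => cumul_approx n p q)).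

Lemma cumul_ge p q n : (0 < q)%N -> cumul_approx n p q <= cumul p q.
Proof.
move=> q0; apply: ub_le_sup; last by exists n.
by exists (cumul_upper 0 p q) => _ [m _ <-]; apply: cumul_approx_le_upper.
Qed.

Lemma cumul_le p q n : (0 < q)%N -> cumul p q <= cumul_upper n p q.
Proof.
move=> q0; apply: ge_sup; first by exists (cumul_approx 0 p q), 0%N.
by move=> _ [m _ <-]; apply: cumul_approx_le_upper.
Qed.

(** The linear bound on [U] bounds the mass of a cell of level [n] by the left-hand side; this
    explicit rate makes [cumul] computable. *)
Lemma mass_cell_small m n : (2 * m + 4 <= n)%N ->
  (1 + n * r)%:R / (r ^ n)%:R <= 2^-1 ^+ m :> R.
Proof.
move=> le_mn; rewrite exprVn ler_pdivrMr ?ltr0n // ler_pdivlMl ?exprn_gt0 //.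
rewrite -natrX -natrM ler_nat.
(* Here [t >= m + 2], so [n <= 2 * t < 2 ^ t.+1], while [r ^ n] still has room for the factors
   [2 ^ m] and [r]. *)
have [t tE] : exists t, n = (t + m).+2 by exists (n - m - 2)%N; lia.
have le_t : ((t + m).+2 < 2 ^ t.+1)%N.
  by have := ltn_expl t (ltnSn 1); rewrite expnS; lia.
apply: leq_trans (_ : 2 ^ m * (2 ^ t.+1 * r) <= _)%N.
  rewrite leq_mul2l; apply/orP; right.
  apply: leq_trans (_ : n.+1 * r <= _)%N; first by rewrite mulSn leq_add2r.
  by rewrite leq_mul2r tE le_t orbT.
rewrite tE mulnA -expnD expnSr leq_mul2r addnS addnC.
by rewrite leq_exp2r // r_gt1 orbT.
Qed.

Lemma cumul_approx_dist m n p q : (0 < q)%N -> (2 * m + 4 <= n)%N ->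
  `|cumul_approx n p q - cumul p q| <= 2^-1 ^+ m.
Proof.
move=> q0 le_mn; rewrite distrC ger0_norm ?subr_ge0 ?cumul_ge // lerBlDl.
apply: le_trans (cumul_le p n q0) _; apply: le_trans (massS _ _) _.
by rewrite lerD2l mass_cell_small.
Qed.

Lemma cumul_scale c p q : (0 < c)%N -> cumul (c * p) (c * q) = cumul p q.
Proof.
move=> c0; rewrite /cumul /cumul_approx.
by under eq_fun do rewrite -mulnA divnMl //.
Qed.

Lemma cumul_mono p q p' q' : (0 < q)%N -> (0 < q')%N -> (p * q' <= p' * q)%N ->
  cumul p q <= cumul p' q'.
Proof.
move=> q0 q0' le_pq; apply: ge_sup; first by exists (cumul_approx 0 p q), 0%N.
move=> _ [n _ <-]; apply: le_trans (cumul_ge p' n q0').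
rewrite /cumul_approx mass_mono // leq_divRL // -(leq_pmul2r q0).
have := leq_trunc_div (p * r ^ n) q; move: (_ %/ _)%N => x le_x.
apply: leq_trans (_ : p * r ^ n * q' <= _)%N.
  by rewrite mulnAC leq_mul2r le_x orbT.
by rewrite mulnAC [leqRHS]mulnAC leq_mul2r le_pq orbT.
Qed.

(** The interval from [p / q] to [p' / q'] lies in cell [j] of level [n], so the deep cells counted
    in it have density at least [L]; the error from rounding its endpoints vanishes with depth. *)
Lemma cumul_lower n j L p q p' q' : 0 <= L ->
  (forall l i, (i %/ r ^ l = j)%N -> L <= U (n + l) i) ->
  (0 < q)%N -> (0 < q')%N ->
  (j * q <= p * r ^ n)%N -> (p * q' <= p' * q)%N -> (p' * r ^ n <= j.+1 * q')%N ->
  L * (p'%:R / q'%:R - p%:R / q%:R) <= cumul p' q' - cumul p q.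
Proof.
(* In [(L + 1) * 2^-m], one [2^-m] is the error of the mass up to [p / q], and [L * 2^-m] pays for
   the length lost by rounding the endpoints to level [N]. *)
move=> L0 UL q0 q0' lo le_pp hi; apply: (@le_half_exp _ _ _ (L + 1)) => m.
pose l := (2 * m + 4)%N; pose N := (n + l)%N.
pose x := (p * r ^ N %/ q)%N; pose y := (p' * r ^ N %/ q')%N.
have le_xy : (x <= y)%N.
  rewrite leq_divRL // -(leq_pmul2r q0).
  apply: leq_trans (_ : p * r ^ N * q' <= _)%N.
    by rewrite mulnAC leq_mul2r leq_trunc_div orbT.
  by rewrite mulnAC [leqRHS]mulnAC leq_mul2r le_pp orbT.
have UN i : (x <= i < y)%N -> L <= U N i.
  move=> /andP[xi iy]; apply: UL; apply/eqP; rewrite eqn_leq; apply/andP; split.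
    rewrite -ltnS ltn_divLR // (leq_trans iy) //.
    rewrite -(leq_pmul2r q0') (leq_trans (leq_trunc_div _ _)) //.
    by rewrite /N expnD mulnA [leqRHS]mulnAC leq_mul2r hi orbT.
  rewrite leq_divRL // (leq_trans _ xi) // leq_divRL // mulnAC /N expnD mulnA.
  by rewrite leq_mul2r lo orbT.
have rN0 : 0 < (r ^ N)%:R :> R by rewrite ltr0n.
have h1 : cumul p q <= cumul_approx N p q + 2^-1 ^+ m.
  have := cumul_approx_dist p q0 (leq_addl n (2 * m + 4)).
  by rewrite distrC => /(le_trans (ler_norm _)); rewrite lerBlDl.
have h2 := cumul_ge p' N q0'.
have h3 : L * ((y%:R - x%:R) / (r ^ N)%:R) <= cumul_approx N p' q' - cumul_approx N p q.
  rewrite /cumul_approx -/x -/y mass_sub // mulrA ler_wpM2r ?invr_ge0 //.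
  apply: le_trans (_ : \sum_(x <= i < y) L <= _).
    by rewrite sumr_const_nat -natrB // mulr_natr.
  rewrite big_nat_cond [leRHS]big_nat_cond; apply: ler_sum => i /andP[+ _].
  exact: UN.
have h4 : p'%:R / q'%:R - p%:R / q%:R - (r ^ N)%:R^-1
    <= (y%:R - x%:R) / (r ^ N)%:R :> R.
  have hx : x%:R / (r ^ N)%:R <= p%:R / q%:R :> R.
    rewrite ler_pdivrMr // mulrAC ler_pdivlMr ?ltr0n // -!natrM ler_nat.
    exact: leq_trunc_div.
  have hy : p'%:R / q'%:R <= (y%:R + 1) / (r ^ N)%:R :> R.
    rewrite ler_pdivrMr ?ltr0n // mulrAC ler_pdivlMr // natr1 -!natrM ler_nat.
    by rewrite ltnW // ltn_ceil.
  by move: hx hy; rewrite !mulrDl mulNr mul1r; lra.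
have h5 : (r ^ N)%:R^-1 <= 2^-1 ^+ m :> R.
  rewrite exprVn lef_pV2 ?posrE ?exprn_gt0 // -natrX ler_nat.
  rewrite (leq_trans (_ : _ <= 2 ^ N)%N) ?leq_exp2l ?leq_exp2r //; lia.
have := ler_wpM2l L0 h4; have := ler_wpM2l L0 h5.
move: h1 h2 h3 {h4 h5 rN0}; move: (_^-1) (_ / _) (_ / _) (_ / _) => a b c d.
lra.
Qed.

End Measure.

(** * Change of base *)

Section Rebase.
Variables (R : realType) (r k : nat) (U : nat -> nat -> R).
Hypotheses (r_gt1 : (1 < r)%N) (k_gt0 : (0 < k)%N).
Hypothesis U_ge0 : forall n j, 0 <= U n j.
Hypothesis U_mart : gmartingale r U.
Hypothesis U_le : forall n j, U n j <= (1 + n * r)%:R.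

(** The mean density over the interval from [p / k^m] to [(p + 1) / k^m]. *)
Definition rebase m p : R :=
  (k ^ m)%:R * (cumul r U p.+1 (k ^ m) - cumul r U p (k ^ m)).

Lemma rebase_ge0 m p : 0 <= rebase m p.
Proof.
rewrite mulr_ge0 // subr_ge0 cumul_mono ?expn_gt0 ?k_gt0 //.
by rewrite leq_mul2r leqnSn orbT.
Qed.

(** The increments of [cumul] over the [k] subintervals telescope. *)
Lemma rebase_mart : gmartingale k rebase.
Proof.
move=> m p; rewrite /rebase -mulr_sumr expnS natrM -mulrA; congr (_ * (_ * _)).
pose c i := cumul r U i (k * k ^ m)%N.
have tele a x : \sum_(i < x) (c (a + i).+1 - c (a + i)%N) = c (a + x)%N - c a.
  elim: x => [|x IH]; first by rewrite big_ord0 addn0 subrr.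
  by rewrite big_ord_recr /= IH addnS; ring.
rewrite [LHS](tele (p * k)%N k).
by rewrite /c -mulSnr !(mulnC _ k) !cumul_scale.
Qed.

End Rebase.

(** * Computability of the savings transform and of the change of base *)

Section Computability.
Variables (R : realType) (r k : nat).
Hypotheses (r_gt1 : (1 < r)%N) (k_gt0 : (0 < k)%N).

Local Notation creal2 X :=
  (creal 2 (fun v => X (nth 0 v 0)%N (nth 0 v 1)%N : R)).

Ltac solve_rec := repeat first
  [ apply: rec_const | apply: rec_head
  | apply: rec_nth; done | apply: rec_nth_behead; done
  | apply: rec_succ | apply: rec_add | apply: rec_sub | apply: rec_mul
  | apply: rec_exp | apply: rec_div | apply: rec_mod ].

Lemma creal_runmax (W : nat -> nat -> R) : creal2 W ->
  (forall n j, 0 <= W n j) -> creal2 (runmax r W).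
Proof.
move=> cW W0.
apply: (@creal_max1_upto R 2 (fun v => (nth 0 v 0).+1)%N
  (fun i v => W i (nth 0 v 1 %/ r ^ (nth 0 v 0 - i))%N)) => //.
  by solve_rec.
by apply: (creal_comp2 cW); solve_rec.
Qed.

Lemma creal_saving (W : nat -> nat -> R) : creal2 W ->
  (forall n j, 1 <= W n j) -> creal2 (saving r W).
Proof.
move=> cW W1; have W0 n j : 0 <= W n j by apply: le_trans (W1 n j).
have cM := creal_runmax cW W0.
apply: creal_add; first by apply: (creal_nat R (rec_const 2 1)).
apply: (@creal_sum R 2 (nth 0 ^~ 0)%N (fun i v =>
  (W i.+1 (nth 0 v 1 %/ r ^ (nth 0 v 0 - i.+1))%N
    - W i (nth 0 v 1 %/ r ^ (nth 0 v 0 - i))%N)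
    / runmax r W i (nth 0 v 1 %/ r ^ (nth 0 v 0 - i))%N)); first by solve_rec.
apply: creal_mul.
  apply: creal_add; first by apply: (creal_comp2 cW); solve_rec.
  by apply: creal_opp; apply: (creal_comp2 cW); solve_rec.
apply: creal_inv; first by apply: (creal_comp2 cM); solve_rec.
by move=> v _; apply: runmax_ge1.
Qed.

Lemma creal_mass (U : nat -> nat -> R) : creal2 U -> creal2 (mass r U).
Proof.
move=> cU; apply: creal_mul.
  apply: (@creal_sum R 2 (nth 0 ^~ 1)%N (fun i v => U (nth 0 v 0)%N i)).
    by solve_rec.
  by apply: (creal_comp2 cU); solve_rec.
apply: creal_inv => [|v _]; first by apply: creal_nat; solve_rec.
by rewrite ler1n expn_gt0 (ltnW r_gt1).
Qed.

Lemma creal_cumul (U : nat -> nat -> R) : creal2 U ->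
  (forall n j, 0 <= U n j) -> gmartingale r U ->
  (forall n j, U n j <= (1 + n * r)%:R) ->
  creal2 (fun p m => cumul r U p (k ^ m)%N).
Proof.
move=> /creal_mass cG U0 mU leU.
apply: (@creal_lim R 2 (fun m v =>
  cumul_approx r U (2 * m + 4) (nth 0 v 0) (k ^ nth 0 v 1))%N).
  by apply: (creal_comp2 cG); solve_rec.
by move=> m v _; apply: cumul_approx_dist; rewrite // expn_gt0 k_gt0.
Qed.

Lemma creal_rebase (U : nat -> nat -> R) : creal2 U ->
  (forall n j, 0 <= U n j) -> gmartingale r U ->
  (forall n j, U n j <= (1 + n * r)%:R) -> creal2 (rebase r k U).
Proof.
move=> cU U0 mU leU; have cF := creal_cumul cU U0 mU leU.
apply: creal_mul; first by apply: creal_nat; solve_rec.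
apply: creal_add; first by apply: (creal_comp2 (F := fun p m => cumul r U p (k ^ m)%N) cF); solve_rec.
by apply: creal_opp; apply: (creal_comp2 (F := fun p m => cumul r U p (k ^ m)%N) cF); solve_rec.
Qed.

End Computability.

(** * Strings of digits *)

Lemma cvgn_le (R : realType) (u : nat -> R) (l B : R) m :
  (u @ \oo --> l)%classic -> (forall n, (m <= n)%N -> u n <= B) -> l <= B.
Proof.
move=> ul uB; have <- := cvg_lim (@Rhausdorff R) ul.
by apply: limr_le; [apply: (cvgP l) | exists m => // n /uB].
Qed.

Lemma cvg_half_exp (R : realType) (u : nat -> R) (l : R) :
  (forall n, `|u n - l| <= 2^-1 ^+ n) -> (u @ \oo --> l)%classic.
Proof.
move=> ul; apply/cvgrPdist_le => e e0.
have h1 : `|2^-1| < 1 :> R by rewrite ger0_norm ?invr_ge0 // invf_lt1 ?ltr1n.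
have /cvgr0_norm_le/(_ e e0)[m _ hm] := cvg_expr h1.
exists m => // n /hm /= le_e; rewrite distrC; apply: le_trans (ul n) _.
by rewrite (le_trans (ler_norm _)).
Qed.

Section Strings.
Variables (k : nat) (k_gt0 : (0 < k)%N).
Implicit Types s : seq 'I_k.

(* The last n base-k digits of j: only j modulo k ^ n matters. *)
Fixpoint digits (n j : nat) : seq 'I_k :=
  if n is m.+1 then rcons (digits m (j %/ k)%N) (Ordinal (ltn_pmod j k_gt0))
  else [::].

Definition string_value s : nat := foldl (fun (c : nat) (d : 'I_k) => c * k + d)%N 0%N s.

Lemma string_value_rcons s i : string_value (rcons s i) = (string_value s * k + i)%N.
Proof. exact: foldl_rcons. Qed.

Lemma string_code_rcons s i : string_code (rcons s i) = (string_code s * k + i)%N.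
Proof. exact: foldl_rcons. Qed.

Lemma string_codeE s : string_code s = (k ^ size s + string_value s)%N.
Proof.
elim/last_ind: s => // s i IH.
by rewrite string_code_rcons string_value_rcons IH size_rcons expnSr mulnDl addnA.
Qed.

Lemma string_value_lt s : (string_value s < k ^ size s)%N.
Proof.
elim/last_ind: s => // s i IH; rewrite string_value_rcons size_rcons expnSr.
apply: leq_trans (_ : (string_value s).+1 * k <= _)%N; last by rewrite leq_mul2r IH orbT.
by rewrite mulSn addnC ltn_add2r.
Qed.

Lemma digits_string_value s : digits (size s) (string_value s) = s.
Proof.
elim/last_ind: s => // s i IH; rewrite size_rcons string_value_rcons /=.
rewrite divnMDl // divn_small // addn0 IH; congr rcons; apply: val_inj => /=.
by rewrite modnMDl modn_small.
Qed.

Lemma string_code_digits n j : string_code (digits n j) = (k ^ n + j %% k ^ n)%N.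
Proof.
elim: n j => [|n IH] j; first by rewrite expn0 modn1.
rewrite string_code_rcons IH /= mulnDl -addnA -expnSr; congr addn.
rewrite modn_divl -expnSr -(modn_dvdm j (dvdn_mulr (k ^ n) (dvdnn k))) -expnS.
by rewrite -divn_eq.
Qed.

End Strings.

(** * Passage between martingales on strings and computable families on pairs *)

Lemma uniformly_computable_creal (R : realType) k (k_gt0 : (0 < k)%N)
    (M : seq 'I_k -> R) : uniformly_computable M ->
  creal 2 (fun v => M (digits k_gt0 (nth 0 v 0) (nth 0 v 1)))%N.
Proof.
move=> [q [[a [b [c [ra rb rc qE]]]] dq qM]].
pose e w := (k ^ nth 0 w 1 + nth 0 w 2 %% k ^ nth 0 w 1)%N.
pose f (a : 2.-tuple nat -> nat) w := a [tuple e w; nth 0%N w 0].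
have rf g : recursive g -> rec 3 (f g).
  move=> rg; apply: (rec_comp2 (f := fun x y => g [tuple x; y])).
  - rewrite /rec (_ : (fun v : 2.-tuple nat => _) = g) //; apply: funext => v.
    by congr g; apply: val_inj => /=; case: v => -[|x [|y []]].
  - apply: rec_add; first by apply: rec_exp; [exact: rec_const | exact: rec_nth].
    apply: rec_mod; first exact: rec_nth.
    by apply: rec_exp; [exact: rec_const | exact: rec_nth].
  - exact: rec_nth.
exists (fun w => ((f a w)%:R - (f b w)%:R) / (f c w).+1%:R).
  by apply: crat_rec; apply: rf.
move=> m [|n [|j []]] //= _; rewrite /f /e /= -string_code_digits.
set s := digits _ _ _.
have -> : ((a [tuple string_code s; m])%:R - (b [tuple string_code s; m])%:R)
    / (c [tuple string_code s; m]).+1%:R = ratr (q s m) :> R.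
  by rewrite qE fmorph_div rmorphB /= !ratr_nat.
(* Summing the geometric bounds on successive differences; in the limit the distance to [M s] is at
   most [2^-m]. *)
have dist l : `|ratr (q s (m + l)%N) - ratr (q s m)| <= 2^-1 ^+ m - 2^-1 ^+ (m + l) :> R.
  elim: l => [|l IH]; first by rewrite addn0 !subrr normr0.
  rewrite addnS -(subrKA (ratr (q s (m + l)%N))) (le_trans (ler_normD _ _)) //.
  have : `|ratr (q s (m + l).+1) - ratr (q s (m + l)%N)| <= 2^-1 ^+ (m + l).+1 :> R.
    rewrite -rmorphB /= -ratr_norm.
    have := dq s (m + l)%N; rewrite -(ler_rat R) => /le_trans-> //.
    by rewrite rmorphXn /= fmorphV /= ratr_nat.
  by move: IH; rewrite (half_expS R (m + l)); lra.
have upper : M s <= ratr (q s m) + 2^-1 ^+ m.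
  apply: (cvgn_le (m := m) (qM s)) => x /subnKC <-.
  have := dist (x - m)%N; rewrite ler_norml => /andP[_].
  by have := half_exp_ge0 R (m + (x - m)); lra.
have lower : - M s <= - (ratr (q s m) - 2^-1 ^+ m).
  apply: (cvgn_le (m := m) (cvgN (qM s))) => x /subnKC <-.
  have := dist (x - m)%N; rewrite fctE ler_norml => /andP[+ _].
  by have := half_exp_ge0 R (m + (x - m)); lra.
by rewrite ler_norml; apply/andP; split; lra.
Qed.

Lemma creal_uniformly_computable (R : realType) k (k_gt1 : (1 < k)%N)
    (H : nat -> nat -> R) : creal 2 (fun v => H (nth 0 v 0) (nth 0 v 1))%N ->
  uniformly_computable (fun s : seq 'I_k => H (size s) (string_value s)).
Proof.
move=> cH.
(* The length is recovered from the code: for a string of length [n] the code lies in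
   [[k^n, 2 * k^n)], so exactly the powers [k^1, ..., k^n] are counted. *)
pose lg c := (\sum_(l < c) (k ^ l.+1 <= c))%N.
have lgE (s : seq 'I_k) : lg (string_code s) = size s.
  have := string_value_lt s; rewrite /lg string_codeE; set n := size s => lt_v.
  have le_n : (n <= k ^ n + string_value s)%N.
    by rewrite (leq_trans (ltnW (ltn_expl n k_gt1))) // leq_addr.
  rewrite -[RHS](sum_ltn le_n); apply: eq_bigr => l _; congr nat_of_bool.
  apply/idP/idP => [le_l|lt_l]; last first.
    by apply: leq_trans (leq_addr _ _); rewrite leq_exp2l.
  rewrite -(ltn_exp2l _ _ k_gt1) -(ltn_pmul2l (ltnW k_gt1)) -expnS.
  apply: leq_ltn_trans le_l _; apply: leq_trans (_ : 2 * k ^ n <= _)%N; first by lia.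
  by rewrite leq_mul2r k_gt1 orbT.
have rlg : rec 1 (fun v => lg (nth 0 v 0))%N.
  apply: (@rec_sum 1 (nth 0 ^~ 0) (fun l v => k ^ l.+1 <= nth 0 v 0))%N.
    exact: rec_nth.
  apply: rec_leq; last exact: rec_nth_behead.
  by apply: rec_exp; [exact: rec_const | apply/rec_succ/rec_head].
have {cH} [q [a [b [c [ra rb rc qE]]]] qH] : creal 1 (fun v =>
    H (lg (nth 0 v 0)) (nth 0 v 0 - k ^ lg (nth 0 v 0)))%N.
  apply: (creal_comp2 cH) => //; apply: rec_sub; first exact: rec_nth.
  by apply: rec_exp => //; apply: rec_const.
(* With precision [n + 2], successive approximations differ by at most
   [2^-(n+2) + 2^-(n+3) <= 2^-(n+1)]. *)
pose f (a : seq nat -> nat) (v : 2.-tuple nat) := a [:: (nth 0 v 1).+2; nth 0 v 0]%N.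
have rf g : rec 2 g -> recursive (f g).
  move=> rg; apply: (@rec_subst 2 2 g (fun i v =>
    if i is 0%N then (nth 0 v 1).+2 else nth 0 v 0)%N rg) => -[|[]] // _.
    by do 2 apply: rec_succ; apply: rec_nth.
  exact: rec_nth.
pose Q (s : seq 'I_k) n : rat := let v := [tuple string_code s; n] in
  ((f a v)%:R - (f b v)%:R) / (f c v).+1%:R.
have QE s n : ratr (Q s n) = q [:: n.+2; string_code s] :> R.
  by rewrite qE // fmorph_div rmorphB /= !ratr_nat.
have QH s n : `|ratr (Q s n) - H (size s) (string_value s)| <= 2^-1 ^+ n.+2 :> R.
  have := qH n.+2 [:: string_code s] erefl; rewrite /= lgE.
  by rewrite {2}string_codeE addKn -QE.
exists Q; split.
- exists (f a), (f b), (f c); split; [exact: rf..|by []].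
- move=> s n; rewrite -(ler_rat R) ratr_norm rmorphB rmorphXn fmorphV /= ratr_nat.
  have := QH s n.+1; have := QH s n; rewrite !ler_norml.
  have := half_expS R n.+1; have := half_expS R n.+2; have := half_exp_ge0 R n.+2.
  move: (ratr _) (ratr _) (H _ _) => x y h h0 h1 h2 /andP[? ?] /andP[? ?].
  by apply/andP; split; lra.
- move=> s; apply: cvg_half_exp => n; apply: le_trans (QH s n) _.
  have := half_expS R n; have := half_expS R n.+1; have := half_exp_ge0 R n.+2.
  by have := half_exp_ge0 R n.+1; lra.
Qed.

(** * Base-k expansions *)

Section Expansion.
Variables (R : realType) (k : nat).
Hypothesis k_gt1 : (1 < k)%N.
Implicit Types (Z : nat -> 'I_k) (z : R).

Let k_gt0 : (0 < k)%N. Proof. exact: ltnW. Qed.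

Let kn_gt0 n : 0 < (k ^ n)%:R :> R.
Proof. by rewrite ltr0n expn_gt0 k_gt0. Qed.

(** For an expansion of [z], the index of the interval of length [k^-n] that contains [z]. *)
Definition prefix_value Z n : nat := string_value (mkseq Z n).

Lemma prefix_valueS Z n : prefix_value Z n.+1 = (prefix_value Z n * k + Z n)%N.
Proof. by rewrite /prefix_value mkseqS string_value_rcons. Qed.

Lemma prefix_value_div Z n l : (prefix_value Z (n + l) %/ k ^ l = prefix_value Z n)%N.
Proof.
elim: l n => [|l IH] n; first by rewrite addn0 expn0 divn1.
rewrite addnS prefix_valueS expnS divnMA divnMDl // (divn_small (ltn_ord _)) addn0.
exact: IH.
Qed.

Lemma series_prefix_value Z n :
  series (fun i => (Z i)%:R / k%:R ^+ i.+1) n = (prefix_value Z n)%:R / (k ^ n)%:R :> R.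
Proof.
elim: n => [|n IH]; first by rewrite /series /= big_geq // mul0r.
rewrite seriesSr IH prefix_valueS natrD natrM expnSr natrM natrX exprSr.
have : k%:R != 0 :> R by rewrite pnatr_eq0 -lt0n.
have : k%:R ^+ n != 0 :> R by rewrite -natrX gt_eqF.
by move=> ? ?; field; apply/andP.
Qed.

Lemma prefix_value_lt Z n l : (prefix_value Z (n + l) < (prefix_value Z n).+1 * k ^ l)%N.
Proof. by rewrite -ltn_divLR ?expn_gt0 ?k_gt0 // prefix_value_div. Qed.

Lemma half_exp_ge_expn n : (k ^ n)%:R^-1 <= 2^-1 ^+ n :> R.
Proof.
rewrite exprVn lef_pV2 ?posrE ?exprn_gt0 // -natrX ler_nat.
by case: n => // n; rewrite leq_exp2r.
Qed.

Lemma base_expansion_bounds z Z : base_expansion z Z ->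
  forall n, (prefix_value Z n)%:R <= z * (k ^ n)%:R < (prefix_value Z n).+1%:R.
Proof.
move=> [Zz Zinf].
have upper n : z <= (prefix_value Z n).+1%:R / (k ^ n)%:R.
  apply: (cvgn_le (m := n) Zz) => x /subnKC <-; rewrite series_prefix_value.
  rewrite ler_pdivrMr // mulrAC ler_pdivlMr // -!natrM ler_nat expnD.
  rewrite mulnA [leqRHS]mulnAC leq_mul2r ltnW ?orbT //.
  exact: prefix_value_lt.
move=> n; apply/andP; split.
  rewrite -ler_pdivrMr // -lerN2.
  apply: (cvgn_le (m := n) (cvgN Zz)) => x /subnKC <-.
  rewrite fctE series_prefix_value lerN2 ler_pdivlMr // mulrAC ler_pdivrMr //.
  rewrite -!natrM ler_nat expnD mulnA [leqLHS]mulnAC leq_mul2r.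
  rewrite -leq_divRL ?expn_gt0 ?k_gt0 // prefix_value_div leqnn orbT //.
(* A later digit different from [k - 1] leaves a gap before the right endpoint, which makes the
   upper bound strict. *)
have [m nm Zm] := Zinf n.
rewrite -ltr_pdivlMr //; apply: le_lt_trans (upper m.+1) _.
rewrite ltr_pdivrMr // mulrAC ltr_pdivlMr // -!natrM ltr_nat.
move: nm Zm => /subnKC <-; move: (m - n)%N => l Zm.
have lt1 := prefix_value_lt Z n l; rewrite prefix_valueS -(addnS n l) expnD mulnA.
have lt2 : ((Z (n + l)).+1 < k)%N by have := ltn_ord (Z (n + l)%N); lia.
rewrite mulnAC ltn_mul2r expn_gt0 k_gt0 /= expnS.
apply: leq_trans (_ : (prefix_value Z (n + l)).+1 * k <= _)%N; first by lia.
by rewrite (mulnC k) mulnA leq_mul2r lt1 orbT.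
Qed.

Lemma base_expansion_exists z : 0 <= z < 1 -> exists Z, base_expansion z Z.
Proof.
move=> /andP[z0 z1].
(* The integer parts of [z * k^n] will be the prefix values, and their last digits the expansion. *)
pose t n := Num.truncn (z * (k ^ n)%:R).
pose Z n : 'I_k := Ordinal (ltn_pmod (t n.+1) k_gt0).
have tP n : (t n)%:R <= z * (k ^ n)%:R < (t n).+1%:R.
  by apply: truncn_itv; rewrite mulr_ge0.
have tS n : (t n.+1 %/ k = t n)%N.
  have k0 : 0 < k%:R :> R by rewrite ltr0n.
  apply/esym/truncn_def; have /andP[lo hi] := tP n.+1.
  apply/andP; split.
    rewrite -(ler_pM2r k0 (t n.+1 %/ k)%:R) -mulrA -!natrM -expnSr.
    by apply: le_trans lo; rewrite ler_nat leq_trunc_div.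
  rewrite -(ltr_pM2r k0 _ (t n.+1 %/ k).+1%:R) -mulrA -!natrM -expnSr.
  by apply: lt_le_trans hi _; rewrite ler_nat ltn_ceil.
have pE n : prefix_value Z n = t n.
  elim: n => [|n IH]; last by rewrite prefix_valueS IH -tS -divn_eq.
  by apply/esym/truncn_def; rewrite mulr1 z0.
exists Z; split.
  apply: cvg_half_exp => n; rewrite series_prefix_value pE.
  apply: le_trans (half_exp_ge_expn n).
  have /andP[lo hi] := tP n.
  rewrite distrC ger0_norm ?subr_ge0 ?ler_pdivrMr // lerBlDl.
  by rewrite -[X in _ + X]mul1r -mulrDl natr1 ler_pdivlMr // ltW.
(* If all digits from [n] on were [k - 1], then [t (n + l) + 1 = (t n + 1) * k^l] for all [l], and
   [z] would be at least [(t n + 1) / k^n], against [tP n]. *)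
move=> n; apply: contrapT => noZ.
have Zk l : (Z (n + l)%N : nat) = k.-1.
  by apply: contrapT => Znl; apply: noZ; exists (n + l)%N => //; apply: leq_addr.
have pl l : ((t (n + l)).+1 = (t n).+1 * k ^ l)%N.
  elim: l => [|l IH]; first by rewrite addn0 muln1.
  rewrite -pE addnS prefix_valueS Zk pE expnSr mulnA -IH mulSn; lia.
have /andP[_] := tP n; rewrite ltNge => /negP; apply.
rewrite -ler_pdivrMr //; apply: (@le_half_exp R _ _ 1) => l.
have /andP[lo _] := tP (n + l)%N.
apply: le_trans (_ : z + (k ^ (n + l))%:R^-1 <= _).
  have -> : (t n).+1%:R / (k ^ n)%:R = (t (n + l)).+1%:R / (k ^ (n + l))%:R :> R.
    rewrite pl expnD !natrM; field.
    by rewrite !gt_eqF.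
  by rewrite ler_pdivrMr // mulrDl mulVf ?gt_eqF // -natr1 lerD2r.
rewrite lerD2l mul1r; apply: le_trans (half_exp_ge_expn l).
by rewrite lef_pV2 ?posrE // ler_nat leq_exp2l // leq_addl.
Qed.

End Expansion.

(** * Unboundedness carried over between two expansions of one real *)

Section Transfer.
Variables (R : realType) (r k : nat) (U : nat -> nat -> R).
Hypotheses (r_gt1 : (1 < r)%N) (k_gt1 : (1 < k)%N).
Hypothesis U_ge0 : forall n j, 0 <= U n j.
Hypothesis U_mart : gmartingale r U.
Hypothesis U_le : forall n j, U n j <= (1 + n * r)%:R.
Hypothesis U_keep : forall n l j, U n (j %/ r ^ l)%N - 1 <= U (n + l) j.

Let rn_gt0 n : 0 < (r ^ n)%:R :> R.
Proof. by rewrite ltr0n expn_gt0 (ltnW r_gt1). Qed.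

Let kn_gt0 n : 0 < (k ^ n)%:R :> R.
Proof. by rewrite ltr0n expn_gt0 (ltnW k_gt1). Qed.

Lemma small_cell (d : R) : 0 < d -> exists m, (k ^ m)%:R^-1 <= d.
Proof.
move=> d0; apply: contrapT => noM.
suff : d <= 0 by rewrite leNgt d0.
apply: (@le_half_exp R _ _ 1) => m; rewrite add0r mul1r.
apply: le_trans (half_exp_ge_expn R k_gt1 m).
by rewrite leNgt; apply/negP => /ltW; apply: contra_not noM => ?; exists m.
Qed.

Lemma le_frac a b c d : (0 < b)%N -> (0 < d)%N ->
  (a%:R / b%:R <= c%:R / d%:R :> R) = (a * d <= c * b)%N.
Proof.
move=> b0 d0.
by rewrite ler_pdivrMr ?ltr0n // mulrAC ler_pdivlMr ?ltr0n // -!natrM ler_nat.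
Qed.

Lemma rebase_unbounded (z : R) (Zr : nat -> 'I_r) (Zk : nat -> 'I_k) :
  base_expansion z Zr -> base_expansion z Zk ->
  (forall B, exists n, B <= U n (prefix_value Zr n)) ->
  forall B, exists m, B <= rebase r k U m (prefix_value Zk m).
Proof.
move=> /(base_expansion_bounds r_gt1)-jP /(base_expansion_bounds k_gt1)-pP Uinf B.
wlog B0 : B / 0 <= B => [hB|].
  have [m Bm] := hB _ (normr_ge0 B); exists m; exact: le_trans (ler_norm _) Bm.
set j := prefix_value Zr in jP Uinf; set p := prefix_value Zk in pP *.
have rN n : (0 < r ^ n)%N by rewrite expn_gt0 (ltnW r_gt1).
have kN n : (0 < k ^ n)%N by rewrite expn_gt0 (ltnW k_gt1).
have keep n L : L + 1 <= U n (j n) ->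
    forall l i, (i %/ r ^ l)%N = j n -> L <= U (n + l) i.
  by move=> LU l i ij; have := U_keep n l i; rewrite ij; lra.
have small n : exists m, (k ^ m)%:R^-1 <= (j n).+1%:R / (r ^ n)%:R - z.
  by apply: small_cell; rewrite subr_gt0 ltr_pdivlMr //; case/andP: (jP n).
have hiE n m : (k ^ m)%:R^-1 <= (j n).+1%:R / (r ^ n)%:R - z ->
    ((p m).+1 * r ^ n <= (j n).+1 * k ^ m)%N.
  move=> km; rewrite -le_frac // -natr1 mulrDl mul1r.
  have /andP[pz _] := pP m; move: pz; rewrite -ler_pdivrMr // => pz; lra.
have [[n0 zn0]|nodyad] := pselect (exists n, z * (r ^ n)%:R = (j n)%:R).
  (* One of the two extra units is lost in passing from level [n1] to [n], the other inside the
     interval of level [n]. As [n >= n0], [z] is a left endpoint at level [n] too. *)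
  have [n1] := Uinf (B * (r ^ n0)%:R + 2).
  pose n := (n1 + n0)%N; have := U_keep n1 n0 (j n); rewrite prefix_value_div // => Un1 Un.
  have jnE : z = (j n)%:R / (r ^ n)%:R.
    have zE : z = (j n0)%:R / (r ^ n0)%:R by rewrite -zn0 mulfK ?gt_eqF.
    have /andP[lo hi] := jP n; move: lo hi.
    have -> : z * (r ^ n)%:R = (j n0 * r ^ n1)%:R.
      by rewrite zE /n expnD !natrM; field; rewrite gt_eqF.
    rewrite ler_nat ltr_nat => lo hi.
    have -> : j n = (j n0 * r ^ n1)%N by lia.
    by rewrite zE /n expnD !natrM; field; rewrite !gt_eqF.
  have [m /hiE hi] := small n; exists m.
  have /andP[pz zp] := pP m.
  have lo : (p m * r ^ n <= j n * k ^ m)%N.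
    by rewrite -le_frac // -jnE ler_pdivrMr.
  have mid : (j n * k ^ m <= (p m).+1 * r ^ n)%N.
    by rewrite -le_frac // -jnE ler_pdivlMr // ltW.
  have L0 : 0 <= B * (r ^ n0)%:R by rewrite mulr_ge0.
  have LU : B * (r ^ n0)%:R + 1 <= U n (j n) by lra.
  (* The density is bounded below only on the part of the [k]-adic interval right of [z]; the part
     on the left has nonnegative mass by monotonicity. *)
  have := cumul_lower r_gt1 U_ge0 U_mart U_le L0 (keep n _ LU) (rN n) (kN m)
    (leqnn _) mid hi.
  have := cumul_mono r_gt1 U_ge0 U_mart (kN m) (rN n) lo.
  rewrite -jnE => mono lower.
  (* Since [z * r^n0] is an integer, [r^n0] times the fraction of the [k]-adic interval right of [z]
     is a positive integer. This is why the density was asked to reach [B * r^n0]. *)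
  have gap : 1 <= (r ^ n0)%:R * ((p m).+1%:R - z * (k ^ m)%:R).
    have : 0 < (r ^ n0)%:R * ((p m).+1%:R - z * (k ^ m)%:R) by rewrite mulr_gt0 // subr_gt0.
    have -> : (r ^ n0)%:R * ((p m).+1%:R - z * (k ^ m)%:R)
        = (r ^ n0 * (p m).+1)%:R - (j n0 * k ^ m)%:R by rewrite !natrM -zn0; ring.
    by rewrite subr_gt0 ltr_nat lerBrDr -(natrD _ 1) ler_nat.
  apply: le_trans (_ : B * ((r ^ n0)%:R * ((p m).+1%:R - z * (k ^ m)%:R)) <= _).
    by rewrite ler_peMr.
  apply: le_trans (_ : (k ^ m)%:R * (B * (r ^ n0)%:R * ((p m).+1%:R / (k ^ m)%:R - z)) <= _).
    by rewrite le_eqVlt; apply/orP; left; apply/eqP; field; rewrite gt_eqF.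
  by rewrite ler_pM2l //; lra.
have [n Un] := Uinf (B + 1).
(* Now [z] is interior to its [r]-adic interval, so a [k]-adic interval around [z] no longer than
   the distance to either end lies inside. *)
have zn : (j n)%:R / (r ^ n)%:R < z.
  have /andP[lo _] := jP n; rewrite ltr_pdivrMr // lt_neqAle lo andbT.
  by apply/eqP => jz; apply: nodyad; exists n.
have [m km] : exists m, (k ^ m)%:R^-1 <=
    Num.min (z - (j n)%:R / (r ^ n)%:R) ((j n).+1%:R / (r ^ n)%:R - z).
  apply: small_cell; rewrite lt_min !subr_gt0 zn ltr_pdivlMr //=.
  by case/andP: (jP n).
move: km; rewrite le_min => /andP[km1 /hiE hi]; exists m.
have lo : (j n * k ^ m <= p m * r ^ n)%N.
  rewrite -le_frac //; have /andP[_ /ltW] := pP m.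
  rewrite -ler_pdivlMr // -natr1 mulrDl mul1r; lra.
have := cumul_lower r_gt1 U_ge0 U_mart U_le B0 (keep n _ Un) (kN m) (kN m)
  lo (leq_mul (leqnSn _) (leqnn _)) hi.
rewrite -mulrBl -natrB // subSnn mul1r ler_pdivrMr // mulrC.
by [].
Qed.

End Transfer.

(** * From success in base [r] to success in base [k] *)

Theorem theorem3p7 (R : realType) (z : R) (k r : nat)
    (hz : 0 <= z < 1) (hk : (2 <= k)%N) (hr : (2 <= r)%N) :
  computably_random k z -> computably_random r z.
Proof.
move=> [Zk eZk randZk]; have [Zr eZr] := base_expansion_exists hr hz.
exists Zr => // M [M0 mM] cM Minf.
have k_gt0 : (0 < k)%N := ltnW hk; have r_gt0 : (0 < r)%N := ltnW hr.
pose W n j := 1 + M (digits r_gt0 n j).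
have W1 n j : 1 <= W n j by rewrite lerDl.
have mW : gmartingale r W.
  move=> n j; rewrite big_split /= sumr_const card_ord mulrDr mulr1 -mM.
  congr (_ + _); apply: eq_bigr => i _; congr (M (rcons _ _)).
    by rewrite divnMDl // divn_small // addn0.
  by apply: val_inj; rewrite /= modnMDl modn_small.
have cW : creal 2 (fun v => W (nth 0 v 0) (nth 0 v 1))%N.
  apply: creal_add; first exact: (creal_nat R (rec_const 2 1)).
  exact: uniformly_computable_creal.
pose U := saving r W.
have U0 : forall n j, 0 <= U n j by apply: saving_ge0.
have mU : gmartingale r U by apply: saving_mart.
have leU : forall n j, U n j <= (1 + n * r)%:R by apply: saving_le.
have cU := creal_saving r cW W1.
have Uinf B : exists n, B <= U n (prefix_value Zr n).
  (* A bound [B] for [U] along the expansion would bound [M] there by [W 0 0 * expR B], with [W 0 0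
     = 1 + M [::]]. *)
  apply: contrapT => noB; apply: Minf.
  exists ((1 + M [::]) * expR B) => _ [n _ <-].
  have MW : M (mkseq Zr n) <= W n (prefix_value Zr n).
    rewrite /W /prefix_value -{2}(size_mkseq Zr n) digits_string_value.
    by rewrite lerDr.
  apply: le_trans MW _; apply: le_trans (saving_unbounded r W1 n _) _.
  rewrite ler_wpM2l ?addr_ge0 // ler_expR leNgt; apply/negP => /ltW B_le.
  by apply: noB; exists n.
pose N (s : seq 'I_k) := rebase r k U (size s) (string_value s).
have mN : martingale N.
  split=> s; first exact: rebase_ge0.
  rewrite /N -(rebase_mart r U k_gt0); apply: eq_bigr => i _.
  by rewrite size_rcons string_value_rcons.
have cN : uniformly_computable N.
  by apply: creal_uniformly_computable => //; apply: creal_rebase.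
apply: (randZk N mN cN).
move=> [B NB].
have [m] := rebase_unbounded hr hk U0 mU leU (@saving_keep _ _ _ W1) eZr eZk Uinf (B + 1).
apply/negP; rewrite -ltNge; apply: le_lt_trans (_ : B < _); last by rewrite ltrDl.
by apply: NB; exists m => //; rewrite /N size_mkseq.
Qed.
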